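(* Let $n$ be a positive integer and let $(A_{abc})_{1\le a,b,c\le n}$ be an array of complex numbers. For $1\le k\le n$ put $$\Sigma_2(k)=\sum_{b,c=1}^k A_{kbc}+\sum_{a,c=1}^k A_{akc}+\sum_{a,b=1}^k A_{abk},\qquad \Sigma_1(k)=\sum_{a=1}^k A_{akk}+\sum_{b=1}^k A_{kbk}+\sum_{c=1}^k A_{kkc},\qquad \Sigma_0(k)=A_{kkk}.$$ Then $$\sum_{k=1}^n\{\Sigma_2(k)-\Sigma_1(k)+\Sigma_0(k)\}=\sum_{1\le a,b,c\le n}A_{abc}.$$
   Context: The indices $a,b,c$ range over integers. *)

(* Defs.v *)
From HB Require Import structures.
From mathcomp Require Import all_boot all_order all_algebra.
From mathcomp Require Import complex.
From mathcomp Require Import reals.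

Set Implicit Arguments.
Unset Strict Implicit.
Unset Printing Implicit Defensive.

Import GRing.Theory.

Local Open Scope ring_scope.
Local Open Scope complex_scope.

(* The complex numbers are R[i], with R : realType.  An array with indices in
   {1, ..., n} is a function on nat of which only the values at indices in that
   range are used; \sum_(1 <= i < k.+1) is the sum over 1 <= i <= k. *)

Definition Sigma2 (R : realType) (A : nat -> nat -> nat -> R[i]) (k : nat)
    : R[i] :=
  \sum_(1 <= b < k.+1) \sum_(1 <= c < k.+1) A k b c
  + \sum_(1 <= a < k.+1) \sum_(1 <= c < k.+1) A a k c
  + \sum_(1 <= a < k.+1) \sum_(1 <= b < k.+1) A a b k.

Definition Sigma1 (R : realType) (A : nat -> nat -> nat -> R[i]) (k : nat)
    : R[i] :=
  \sum_(1 <= a < k.+1) A a k k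
  + \sum_(1 <= b < k.+1) A k b k
  + \sum_(1 <= c < k.+1) A k k c.

Definition Sigma0 (R : realType) (A : nat -> nat -> nat -> R[i]) (k : nat)
    : R[i] :=
  A k k k.

(* Main.v *)
Require Import Defs.
From HB Require Import structures.
From mathcomp Require Import all_boot all_order all_algebra.
From mathcomp Require Import complex.
From mathcomp Require Import reals.
From mathcomp Require Import ring.

(* The bracket at k is the sum of A over the shell of triples with maximum k,
   by inclusion-exclusion on which of the indices equal k; the shells partition
   the cube, so the sum telescopes. *)

Set Implicit Arguments.
Unset Strict Implicit.
Unset Printing Implicit Defensive.

Import GRing.Theory.

Local Open Scope ring_scope.
Local Open Scope complex_scope.

(** A triple with maximum k and exactly j indices equal to k is counted j times in [Sigma2], C(j,2)
    times in [Sigma1] and C(j,3) times in [Sigma0]; j - C(j,2) + C(j,3) = 1 for j = 1, 2, 3.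
    [sum_cube_recr] is this count, and induction on n adds up the shells. *)

Lemma sum_square_recr (V : nmodType) (k : nat) (F : nat -> nat -> V) :
  \sum_(1 <= i < k.+2) \sum_(1 <= j < k.+2) F i j
  = \sum_(1 <= i < k.+1) \sum_(1 <= j < k.+1) F i j
    + \sum_(1 <= i < k.+1) F i k.+1 + \sum_(1 <= j < k.+1) F k.+1 j
    + F k.+1 k.+1.
Proof.
rewrite big_nat_recr //= -big_split /= [X in _ + X]big_nat_recr //= addrA.
by do 2 congr (_ + _); apply: eq_bigr => i _; rewrite big_nat_recr.
Qed.

Lemma sum_cube_recr (R : realType) (k : nat) (A : nat -> nat -> nat -> R[i]) :
  \sum_(1 <= a < k.+2) \sum_(1 <= b < k.+2) \sum_(1 <= c < k.+2) A a b c
  = \sum_(1 <= a < k.+1) \sum_(1 <= b < k.+1) \sum_(1 <= c < k.+1) A a b c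
    + (Sigma2 A k.+1 - Sigma1 A k.+1 + Sigma0 A k.+1).
Proof.
rewrite big_nat_recr //= (eq_bigr _ (fun a _ => sum_square_recr k (A a))).
rewrite !big_split /= /Sigma2 /Sigma1 /Sigma0 !sum_square_recr.
rewrite !(big_nat_recr k.+1) //=.
(* All ranges now stop at k, so the open faces, open edges and corner of the shell are atoms: faces
   occur once, edges 2 - 1 times, the corner 3 - 3 + 1 times. *)
by ring.
Qed.

Theorem mainTheorem1 (R : realType) (n : nat) (hn : (0 < n)%N)
    (A : nat -> nat -> nat -> R[i]) :
  \sum_(1 <= k < n.+1) (Sigma2 A k - Sigma1 A k + Sigma0 A k)
  = \sum_(1 <= a < n.+1) \sum_(1 <= b < n.+1) \sum_(1 <= c < n.+1) A a b c.
Proof.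
elim: n {hn} => [|n IHn]; first by rewrite !big_geq.
by rewrite sum_cube_recr -IHn big_nat_recr.
Qed.
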